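(* Let $(\Phi_n)_{n=1}^\infty$ be a non-autonomous iterated function system in $\mathbb{R}^d$ satisfying the bounded neighbourhood condition, and let $K$ be the associated non-autonomous self-similar set. Then $$\dim_{\mathrm A} K = \lim_{m\to\infty}\sup_{n\in\mathbb{N}}\theta(n,m)=\lim_{m\to\infty}\limsup_{n\to\infty}\theta(n,m)=\inf_{m\in\mathbb{N}}\limsup_{n\to\infty}\theta(n,m)$$ (in particular, the limits exist).
   Context: **Non-autonomous IFS.** Let $\mathbb{N}=\{1,2,\ldots\}$ and work in Euclidean $\mathbb{R}^d$. For each $n\in\mathbb{N}$ let $\mathcal{J}_n$ be a finite index set with $\#\mathcal{J}_n\ge 2$ and let $\Phi_n=\{S_{n,j}\}_{j\in\mathcal{J}_n}$ be an indexed family of maps $S_{n,j}(x)=r_{n,j}O_{n,j}x+d_{n,j}$ on $\mathbb{R}^d$, where $r_{n,j}\in(0,1)$, $O_{n,j}$ is an orthogonal matrix and $d_{n,j}\in\mathbb{R}^d$. The sequence $(\Phi_n)_{n=1}^\infty$ is a non-autonomous iterated function system (IFS) if there is a non-empty compact set $X\subset\mathbb{R}^d$ with $S_{n,j}(X)\subset X$ for all $n\in\mathbb{N}$, $j\in\mathcal{J}_n$, and $$\lim_{n\to\infty}\sup\{r_{1,j_1}\cdots r_{n,j_n}: j_i\in\mathcal{J}_i,\ i=1,\ldots,n\}=0.$$ Its limit set, called the non-autonomous self-similar set, is the non-empty compact set $$K=\bigcap_{n=1}^\infty\bigcup_{(j_1,\ldots,j_n)\in\mathcal{J}_1\times\cdots\times\mathcal{J}_n}S_{1,j_1}\circ\cdots\circ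 S_{n,j_n}(X).$$ **Symbolic space.** Let $\Delta=\prod_{n=1}^\infty\mathcal{J}_n$. For $n\ge 0$, let $\mathcal{T}_n$ be the set of cylinders $[j_1,\ldots,j_n]=\{j_1\}\times\cdots\times\{j_n\}\times\prod_{k>n}\mathcal{J}_k$ with $j_i\in\mathcal{J}_i$ (so $\mathcal{T}_0=\{\Delta\}$), and $\mathcal{T}=\bigcup_{n\ge 0}\mathcal{T}_n$. For $Q=[j_1,\ldots,j_n]$ put $\rho(Q)=r_{1,j_1}\cdots r_{n,j_n}$ (with $\rho(\Delta)=1$), and if $Q\ne\Delta$ let $\widehat{Q}=[j_1,\ldots,j_{n-1}]$ be its parent. For $r>0$ let $\mathcal{T}(r)=\{Q\in\mathcal{T}\setminus\{\Delta\}:\rho(Q)\le r<\rho(\widehat{Q})\}$. The coding map $\pi:\Delta\to\mathbb{R}^d$ is defined by $\{\pi((i_n)_{n=1}^\infty)\}=\bigcap_{n=1}^\infty S_{1,i_1}\circ\cdots\circ S_{n,i_n}(X)$; it satisfies $\pi(\Delta)=K$. **Bounded neighbourhood condition.** For $x\in K$ and $r>0$, let $\mathcal{N}(x,r)=\{Q\in\mathcal{T}(r):\pi(Q)\cap B(x,r)\ne\varnothing\}$, where $B(x,r)$ is the closed ball. The IFS satisfies the bounded neighbourhood condition if $\limsup_{r\to0}\sup_{x\in K}\#\mathcal{N}(x,r)<\infty$. **The numbers $\theta(n,m)$.** For $n,m\in\mathbb{N}$ define the pressure $\phi_{n,m}:\mathbb{R}\to\mathbb{R}$ by $$\phi_{n,m}(t)=\frac1m\log\sum_{j_0\in\mathcal{J}_n}\cdots\sum_{j_{m-1}\in\mathcal{J}_{n+m-1}}\prod_{k=0}^{m-1}r_{n+k,j_k}^{\,t}.$$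 It is convex, differentiable and strictly decreasing with a unique zero, denoted $\theta(n,m)\ge 0$. **Assouad dimension.** $\dim_{\mathrm A}K$ is the infimum of all $s$ for which there is $C>0$ such that for all $0<r\le R<1$ and all $x\in K$, $N_r(B(x,R)\cap K)\le C(R/r)^s$, where $N_r(A)$ is the least number of closed balls of radius $r$ needed to cover $A$. *)

(* Defs.v *)
From HB Require Import structures.
From mathcomp Require Import all_boot all_order all_algebra.
From mathcomp Require Import all_classical all_reals all_analysis.

Set Implicit Arguments.
Unset Strict Implicit.
Unset Printing Implicit Defensive.

Import Order.TTheory GRing.Theory Num.Theory.
Import numFieldNormedType.Exports.

Local Open Scope classical_set_scope.
Local Open Scope ring_scope.

(* The norm that the library puts on matrices is the sup norm, so Euclidean
   balls are built from [enorm].  The topology on ['cV[R]_d] is the same. *)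
Definition enorm (R : realType) (d : nat) (x : 'cV[R]_d) : R :=
  Num.sqrt (\sum_(i < d) x i 0 ^+ 2).

Definition eball (R : realType) (d : nat) (x : 'cV[R]_d) (r : R) :
  set 'cV[R]_d := closed_ball_ (@enorm R d) x r.

(* Levels are numbered from 0: level [n] here is the family Phi_(n+1) of the
   sequence (Phi_n) indexed by n >= 1. *)
Record sim_seq (R : realType) (d : nat) := SimSeq {
  idx : nat -> finType;
  contr : forall n, idx n -> R;
  orth : forall n, idx n -> 'M[R]_d;
  transl : forall n, idx n -> 'cV[R]_d;
  idx_card : forall n, (2 <= #|idx n|)%N;
  contr_itv : forall n (j : idx n), 0 < contr j < 1;
  orth_orthogonal : forall n (j : idx n), (orth j)^T *m orth j = 1%:M
}.

Section NonAutonomousIFS.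
Variables (R : realType) (d : nat) (Phi : sim_seq R d).

Definition sim n (j : idx Phi n) (x : 'cV[R]_d) : 'cV[R]_d :=
  contr j *: (orth j *m x) + transl j.

(* Delta, the product of all the index sets.  Since the index sets are
   nonempty, every finite word (j_1, ..., j_n) is the prefix of length [n] of
   some [w : symb]; objects attached to a finite word are written as functions
   of such a [w] and of [n], and depend only on the first [n] letters of [w]. *)
Definition symb := forall n, idx Phi n.

Definition rho (w : symb) (n : nat) : R := \prod_(k < n) contr (w k).

Fixpoint scomp (w : symb) (n : nat) : 'cV[R]_d -> 'cV[R]_d :=
  if n is m.+1 then scomp w m \o sim (w m) else id.

Definition is_nifs (X : set 'cV[R]_d) : Prop :=
  [/\ X !=set0, compact X,
      (forall n (j : idx Phi n), sim j @` X `<=` X)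
    & (fun n => sup [set rho w n | w in [set: symb]]) @ \oo --> (0 : R)].

Definition limit_set (X : set 'cV[R]_d) : set 'cV[R]_d :=
  \bigcap_(n in [set n | (1 <= n)%N])
    \bigcup_(w in [set: symb]) (scomp w n @` X).

Definition cylinder (w : symb) (n : nat) : set symb :=
  [set v | forall k, (k < n)%N -> v k = w k].

(* T(r).  As every index set has at least two elements, the length of a
   cylinder, hence rho(Q) and the parent of Q, are determined by the set Q. *)
Definition cut_at (r : R) : set (set symb) :=
  [set Q | exists (w : symb) (n : nat),
     Q = cylinder w n.+1 /\ rho w n.+1 <= r < rho w n].

(* The intersection is a singleton when [is_nifs X] holds. *)
Definition coding (X : set 'cV[R]_d) (w : symb) : 'cV[R]_d :=
  get (\bigcap_(n in [set n | (1 <= n)%N]) (scomp w n @` X)).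

Definition neighbours (X : set 'cV[R]_d) (x : 'cV[R]_d) (r : R) :
    set (set symb) :=
  [set Q | cut_at r Q /\ (coding X @` Q) `&` eball x r !=set0].

(* [counting A] is the number of elements of [A], +oo if [A] is infinite. *)
Definition bounded_neighbourhood (X : set 'cV[R]_d) : Prop :=
  (limf_esup
    (fun r : R => ereal_sup
       [set (counting (neighbours X x r) : \bar R) | x in limit_set X])
    (0^'+) < +oo)%E.

Definition pressure (n m : nat) (t : R) : R :=
  m%:R^-1 * ln (\sum_(j : {dffun forall k : 'I_m, idx Phi (n + k)})
                  \prod_(k < m) contr (j k) `^ t).

(* [theta n m] is the number theta(n+1, m) in 1-based numbering of the levels;
   [m] is a length and is meaningful for [m >= 1] only. *)
Definition theta (n m : nat) : R := get [set t | pressure n m t = 0].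

End NonAutonomousIFS.

Section AssouadDimension.
Variables (R : realType) (d : nat).

Definition cover_number (A : set 'cV[R]_d) (r : R) : \bar R :=
  ereal_inf [set (N%:R : R)%:E | N in
    [set N | exists c : 'I_N -> 'cV[R]_d,
       A `<=` \bigcup_(i in [set: 'I_N]) eball (c i) r]].

Definition assouad_dim (K : set 'cV[R]_d) : \bar R :=
  ereal_inf [set s%:E | s in
    [set s : R | exists2 C : R, 0 < C &
       forall r rr : R, 0 < r -> r <= rr -> rr < 1 ->
       forall x, K x ->
         (cover_number (eball x rr `&` K) r <= (C * (rr / r) `^ s)%:E)%E]].

End AssouadDimension.

(* Main.v *)
(* The sum defining the pressure factorizes over levels, so write Z(n,m,t) for
   the product of the sums of r_{k,j}^t over the levels n <= k < n + m;
   theta(n,m) <= t iff Z(n,m,t) <= 1.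

   Under the bounded neighbourhood condition only boundedly many words which
   are separated at scale r can have their codings in a ball of radius
   comparable to r.  Applied to the siblings of the prefixes of a single word,
   this bounds the number of maps per level and makes the contraction uniform:
   rho(w,n+l) <= 2 kappa^l rho(w,n) with kappa < 1.  The ratios need not be
   bounded away from 0, and this is what replaces such a bound.

   Upper bound: if Z(n,m,s) <= 1 for all large n and t > s, then
   Z(n,l,t) <= K q^l with q < 1.  An induction on the depth covers the part of
   K below a word w by a constant times (rho(w)/r)^t balls of radius r, and
   B(x,R) is reached by boundedly many words with rho(w) <= R.

   Lower bound: if s is an admissible exponent for the Assouad dimension, then
   among the words v extending w by m letters the number of those with
   rho(v) > u rho(w) is at most C u^(-s).  Since all rho(v)/rho(w) are at most
   2 kappa^m, summing over dyadic shells gives Z(n,m,t) <= K q^m for t > s and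
   large n, and the finitely many remaining levels only cost a constant factor;
   hence theta(n,m) <= t for all n once m is large.

   Both bounds together give
   dim_A <= limsup_n theta(n,m) <= sup_n theta(n,m) <= dim_A + epsilon
   for large m, from which the three equalities follow. *)

Require Import Defs.
From HB Require Import structures.
From mathcomp Require Import all_boot all_order all_algebra.
From mathcomp Require Import all_classical all_reals all_analysis.
From mathcomp Require Import ring lra.

Import Order.TTheory GRing.Theory Num.Theory.
Import numFieldNormedType.Exports.

Local Open Scope classical_set_scope.
Local Open Scope ring_scope.

(** Distributivity when the inner index type depends on the factor: dependent functions are traded
    for [fprod], whose sums run over tagged values. It factorizes the sum in [pressure] over the
    levels. *)
Lemma bigA_distr_dffun {R : pzSemiRingType} {I : finType} {T : I -> finType}
    (F : forall i, T i -> R) :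
  \sum_(f : {dffun forall i, T i}) \prod_i F i (f i)
    = \prod_i \sum_(j : T i) F i j.
Proof.
pose P i := [ffun j : T i => F i j].
have -> : \prod_i \sum_(j : T i) F i j
        = \prod_i \sum_(j in tagged_with T i) untag 0 (P i) j.
  apply: eq_bigr => i _; rewrite -(big_tag (fun i => P i)).
  by apply: eq_bigr => j _; rewrite ffunE.
rewrite bigA_distr_big_dep -big_fprod.
rewrite (reindex (@fprod_of_dffun _ _)); last first.
  exact/onW_bij/fprod_of_dffun_bij.
apply: eq_bigr => f _; apply: eq_bigr => i _.
by rewrite ffunE fprodE.
Qed.

(** * Pressure *)

Section Pressure.
Context {R : realType} {d : nat} (Phi : sim_seq R d).

Definition level_sum (n : nat) (t : R) : R := \sum_(j : idx Phi n) contr j `^ t.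

(** This is the quantity Z(n,m,t) of the overview. *)
Definition block_sum (n m : nat) (t : R) : R := \prod_(k < m) level_sum (n + k) t.

Lemma contr_gt0 n (j : idx Phi n) : 0 < contr j.
Proof. by case/andP: (contr_itv j). Qed.

Lemma contr_lt1 n (j : idx Phi n) : contr j < 1.
Proof. by case/andP: (contr_itv j). Qed.

Lemma idx_inhabited n : idx Phi n.
Proof.
have /card_gt0P/sigW[j _] // : (0 < #|idx Phi n|)%N.
by apply: leq_trans (idx_card Phi n).
Qed.

Lemma level_sum_gt0 n t : 0 < level_sum n t.
Proof.
rewrite /level_sum (bigD1 (idx_inhabited n)) //= ltr_pwDl ?powR_gt0 ?contr_gt0//.
by apply: sumr_ge0 => j _; exact: powR_ge0.
Qed.

Lemma block_sum_gt0 n m t : 0 < block_sum n m t.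
Proof. by apply: prodr_gt0 => k _; exact: level_sum_gt0. Qed.

Lemma block_sumS n m t : block_sum n m.+1 t = level_sum n t * block_sum n.+1 m t.
Proof.
rewrite /block_sum big_ord_recl addn0; congr (_ * _).
by apply: eq_bigr => k _; rewrite /= /bump leq0n add1n addnS addSn.
Qed.

Lemma block_sumD n a b t :
  block_sum n (a + b) t = block_sum n a t * block_sum (n + a) b t.
Proof.
rewrite /block_sum big_split_ord /=; congr (_ * _).
by apply: eq_bigr => k _; rewrite addnA.
Qed.

Lemma block_sumE n m t :
  block_sum n m t = \sum_(j : {dffun forall k : 'I_m, idx Phi (n + k)})
                      \prod_(k < m) contr (j k) `^ t.
Proof.
by rewrite (bigA_distr_dffun (T := fun k : 'I_m => idx Phi (n + k))
  (fun k j => contr j `^ t)).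
Qed.

Lemma level_sum_le_card n t : 0 <= t -> level_sum n t <= #|idx Phi n|%:R.
Proof.
move=> t0; rewrite /level_sum -sum1_card natr_sum; apply: ler_sum => j _.
rewrite -(powRr0 (contr j)); apply: ger_powR => //.
by rewrite contr_gt0 ltW ?contr_lt1.
Qed.

Lemma block_sum_le_expn (A N : nat) n m t : 0 <= t ->
  (forall n, (#|idx Phi n| <= A)%N) -> (m <= N)%N ->
  block_sum n m t <= A%:R ^+ N.
Proof.
move=> t0 hA mN.
have A1 : (1 <= A%:R :> R).
  by rewrite ler1n (leq_trans _ (hA 0%N))// (leq_trans _ (idx_card Phi 0)).
apply: le_trans (ler_weXn2l A1 mN).
rewrite -[m in leRHS]card_ord -prodr_const; apply: ler_prod => k _.
rewrite (ltW (level_sum_gt0 _ _))/= (le_trans (level_sum_le_card _ _ t0))//.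
by rewrite ler_nat.
Qed.

Lemma level_sum_anti n : {homo level_sum n : s t /~ s < t}.
Proof.
move=> s t st; apply: ltr_sum => [|j _].
  by apply/hasP; exists (idx_inhabited n); rewrite ?mem_index_enum.
rewrite /powR gt_eqF ?contr_gt0// ltr_expR ltr_nM2r//.
by rewrite ln_lt0 // contr_gt0 contr_lt1.
Qed.

Lemma level_sum_anti_le n : {homo level_sum n : s t /~ s <= t}.
Proof.
by move=> s t; rewrite le_eqVlt => /predU1P[->//|/(level_sum_anti n)/ltW].
Qed.

Lemma block_sum_anti n m : (0 < m)%N -> {homo block_sum n m : s t /~ s < t}.
Proof.
move=> m0 s t st; apply: ltr_prod; last first.
  by move=> k _; rewrite ltW ?level_sum_gt0//= level_sum_anti.
by apply/hasP; exists (Ordinal m0); rewrite ?mem_index_enum.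
Qed.

Lemma block_sum_anti_le n m : {homo block_sum n m : s t /~ s <= t}.
Proof.
move=> s t st; apply: ler_prod => k _.
by rewrite ltW ?level_sum_gt0//= level_sum_anti_le.
Qed.

Lemma continuous_level_sum n : continuous (level_sum n).
Proof.
apply: continuous_big => [|j _]; first exact: add_continuous.
rewrite /powR gt_eqF ?contr_gt0// => t.
apply: (@continuous_comp _ _ _ (fun x : R => x * ln (contr j)) expR).
  by apply: continuousM; [exact: cvg_id|exact: cvg_cst].
exact: continuous_expR.
Qed.

Lemma continuous_block_sum n m : continuous (block_sum n m).
Proof.
apply: continuous_big => [|k _]; first exact: mul_continuous.
exact: continuous_level_sum.
Qed.

Lemma block_sum0_ge1 n m : 1 <= block_sum n m 0.
Proof.
have h k : 1 <= level_sum k 0.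
  rewrite /level_sum; under eq_bigr do rewrite powRr0.
  rewrite sumr_const ler1n; apply: leq_trans (idx_card Phi k); by [].
rewrite /block_sum; elim/big_ind: _ => // x y x1 y1.
by rewrite -[1]mulr1 ler_pM.
Qed.

Lemma level_sum_eventually_le1 n : exists T : R, level_sum n T <= 1.
Proof.
suff [T T0 hT] : exists2 T : R, 0 <= T &
    forall j : idx Phi n, contr j `^ T <= #|idx Phi n|%:R^-1.
  exists T; apply: le_trans (ler_sum _ (fun j _ => hT j)) _.
  rewrite sumr_const -[leLHS]mulr_natl divff// pnatr_eq0 -lt0n.
  exact: leq_trans (idx_card Phi n).
pose c := #|idx Phi n|%:R^-1 : R.
have c0 : 0 < c.
  by rewrite invr_gt0 ltr0n; exact: leq_trans (idx_card Phi n).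
pose f (j : idx Phi n) := `|ln c / ln (contr j)|.
have f0 j : 0 <= f j by exact: normr_ge0.
(* The sum of the [f j] stands in for their maximum: it dominates each exponent that brings a single
   term below 1/#J. *)
exists (\sum_j f j); first by apply: sumr_ge0.
move=> j; have lj : ln (contr j) < 0 by rewrite ln_lt0// contr_gt0 contr_lt1.
rewrite -/c -[leRHS]lnK ?posrE// /powR gt_eqF ?contr_gt0// ler_expR.
rewrite -ler_ndivrMr //; apply: le_trans (ler_norm _) _.
by rewrite (bigD1 j) //= lerDl; apply: sumr_ge0 => k _; exact: f0.
Qed.

Lemma block_sum_eventually_le1 n m : exists T : R, block_sum n m T <= 1.
Proof.
elim: m n => [|m ih] n; first by exists 0; rewrite /block_sum big_ord0.
have [T1 h1] := level_sum_eventually_le1 n; have [T2 h2] := ih n.+1.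
exists (Num.max T1 T2); rewrite block_sumS -[1]mulr1.
apply: ler_pM; [exact/ltW/level_sum_gt0|exact/ltW/block_sum_gt0| |].
  by apply: le_trans h1; apply: level_sum_anti_le; rewrite le_max lexx.
by apply: le_trans h2; apply: block_sum_anti_le; rewrite le_max lexx orbT.
Qed.

(** As [theta] is picked by [get], a zero of the pressure has to be exhibited. The intermediate
    value theorem gives one: the block sum is at least 1 at exponent 0 and at most 1 at a large
    exponent. *)
Lemma theta_spec n m : (0 < m)%N ->
  0 <= theta Phi n m /\ block_sum n m (theta Phi n m) = 1.
Proof.
move=> m0.
have pressureE t : pressure Phi n m t = m%:R^-1 * ln (block_sum n m t).
  by rewrite block_sumE.
have [T hT] := block_sum_eventually_le1 n m.
pose b := Num.max 0 T.
have hb : block_sum n m b <= 1.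
  by apply: le_trans hT; apply: block_sum_anti_le; rewrite le_max lexx orbT.
have b0 : 0 <= b by rewrite le_max lexx.
have [c _ hc] : exists2 c, c \in `[0, b] & block_sum n m c = 1.
  apply: IVT => //; first exact/continuous_subspaceT/continuous_block_sum.
  by rewrite ge_min le_max hb orbT block_sum0_ge1.
have : pressure Phi n m (theta Phi n m) = 0.
  apply: (@getPex _ [set t | pressure Phi n m t = 0]).
  by exists c; rewrite /= pressureE hc ln1 mulr0.
rewrite pressureE => /eqP; rewrite mulf_eq0 invr_eq0 pnatr_eq0 gtn_eqF//= => /eqP h.
have Z1 : block_sum n m (theta Phi n m) = 1.
  by apply: ln_inj; rewrite ?posrE ?block_sum_gt0 ?ltr01// h ln1.
split=> //; rewrite leNgt; apply/negP => /(block_sum_anti n m m0).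
by rewrite Z1 ltNge block_sum0_ge1.
Qed.

Lemma block_sum_le1 n m s : (0 < m)%N -> theta Phi n m <= s -> block_sum n m s <= 1.
Proof.
move=> m0 /(block_sum_anti_le n m); by rewrite (theta_spec n m m0).2.
Qed.

Lemma theta_le n m s : (0 < m)%N -> block_sum n m s <= 1 -> theta Phi n m <= s.
Proof.
move=> m0 h; rewrite leNgt; apply/negP => /(block_sum_anti n m m0).
by rewrite (theta_spec n m m0).2 ltNge h.
Qed.

End Pressure.

(** * Euclidean norm *)

Section EuclideanNorm.
Context {R : realType} {d : nat}.
Implicit Types x y z : 'cV[R]_d.

Lemma enorm_ge0 x : 0 <= enorm x.
Proof. exact: sqrtr_ge0. Qed.

Lemma sqr_enorm x : enorm x ^+ 2 = \sum_(i < d) x i 0 ^+ 2.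
Proof. by rewrite sqr_sqrtr//; apply: sumr_ge0 => i _; exact: sqr_ge0. Qed.

Lemma enormZ (a : R) x : 0 <= a -> enorm (a *: x) = a * enorm x.
Proof.
move=> a0; rewrite /enorm -[in RHS](ger0_norm a0) -sqrtr_sqr -sqrtrM ?sqr_ge0//.
by rewrite mulr_sumr; under eq_bigr do rewrite mxE exprMn.
Qed.

Lemma enormN x : enorm (- x) = enorm x.
Proof. by rewrite /enorm; under eq_bigr do rewrite mxE sqrrN. Qed.

Lemma enormB x y : enorm (x - y) = enorm (y - x).
Proof. by rewrite -enormN opprB. Qed.

Lemma enorm0_coord x : enorm x = 0 -> forall i, x i 0 = 0.
Proof.
move=> x0 i; apply/eqP; rewrite -sqrf_eq0.
have : \sum_(i < d) x i 0 ^+ 2 = 0 by rewrite -sqr_enorm x0 expr0n.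
move/eqP; rewrite psumr_eq0 => [/allP/(_ i)|k _]; last exact: sqr_ge0.
by rewrite mem_index_enum => /(_ isT).
Qed.

(** Cauchy-Schwarz: when both norms are nonzero, the difference of the two sides times 2|x||y| is
    the sum of the squares (|y| x_i - |x| y_i)^2. *)
Lemma dot_le_enorm x y : \sum_(i < d) x i 0 * y i 0 <= enorm x * enorm y.
Proof.
have [x0|xn] := eqVneq (enorm x) 0.
  rewrite x0 mul0r big1// => i _; by rewrite enorm0_coord ?mul0r.
have [y0|yn] := eqVneq (enorm y) 0.
  rewrite y0 mulr0 big1// => i _; by rewrite (enorm0_coord y)// mulr0.
have xp : 0 < enorm x by rewrite lt_def xn enorm_ge0.
have yp : 0 < enorm y by rewrite lt_def yn enorm_ge0.
rewrite -subr_ge0 -(pmulr_rge0 _ (mulr_gt0 (mulr_gt0 (ltr0Sn R 1) xp) yp)).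
have -> : 2 * enorm x * enorm y * (enorm x * enorm y - \sum_(i < d) x i 0 * y i 0)
   = \sum_(i < d) (enorm y * x i 0 - enorm x * y i 0) ^+ 2.
  transitivity (\sum_(i < d) (enorm y ^+ 2 * x i 0 ^+ 2 + enorm x ^+ 2 * y i 0 ^+ 2
      - 2 * enorm x * enorm y * (x i 0 * y i 0))).
    by rewrite !big_split/= sumrN -!mulr_sumr -!sqr_enorm; ring.
  by apply: eq_bigr => i _; ring.
by apply: sumr_ge0 => i _; exact: sqr_ge0.
Qed.

Lemma enormD x y : enorm (x + y) <= enorm x + enorm y.
Proof.
rewrite -(@ler_pXn2r _ 2) ?nnegrE ?addr_ge0 ?enorm_ge0//.
have -> : enorm (x + y) ^+ 2
        = enorm x ^+ 2 + enorm y ^+ 2 + 2 * \sum_(i < d) x i 0 * y i 0.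
  rewrite !sqr_enorm mulr_sumr -!big_split/=.
  by apply: eq_bigr => i _; rewrite mxE; ring.
have := dot_le_enorm x y; nra.
Qed.

Lemma enorm_dist_trans y x z : enorm (x - z) <= enorm (x - y) + enorm (y - z).
Proof. by rewrite -[x - z](subrKA y) enormD. Qed.

Lemma enorm_le_coord (e : R) x :
  0 <= e -> (forall i, `|x i 0| <= e) -> enorm x <= d%:R * e.
Proof.
move=> e0 h; rewrite -(@ler_pXn2r _ 2) ?nnegrE ?mulr_ge0 ?enorm_ge0//.
rewrite sqr_enorm; apply: (@le_trans _ _ (\sum_(i < d) e ^+ 2)).
  by apply: ler_sum => i _; rewrite -real_normK ?num_real// ler_pXn2r ?nnegrE.
rewrite sumr_const card_ord -[leLHS]mulr_natl exprMn ler_wpM2r ?sqr_ge0//.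
by rewrite -natrX ler_nat; case: (d) => // k; rewrite expnS leq_pmulr// expn1.
Qed.

Lemma coord_le_enorm x i : `|x i 0| <= enorm x.
Proof.
rewrite -(@ler_pXn2r _ 2) ?nnegrE ?enorm_ge0// real_normK ?num_real// sqr_enorm.
by rewrite (bigD1 i)//= lerDl; apply: sumr_ge0 => j _; exact: sqr_ge0.
Qed.

Lemma normr_le_enorm x : `|x| <= enorm x.
Proof.
have [x0|/mx_norm_neq0[[i j]]] := eqVneq (mx_norm x) 0.
  by rewrite [leLHS]x0 enorm_ge0.
by rewrite /Num.Def.normr/= => ->; rewrite /= (ord1 j) coord_le_enorm.
Qed.

Lemma enorm_le_normr x : enorm x <= d%:R * `|x|.
Proof.
apply: enorm_le_coord => // i; rewrite [leRHS]mx_normrE.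
exact: (le_bigmax _ (fun k : 'I_d * 'I_1 => `|x k.1 k.2|) (i, 0)).
Qed.

Lemma enorm_orthogonal (M : 'M[R]_d) x : M^T *m M = 1%:M -> enorm (M *m x) = enorm x.
Proof.
have dotE z : \sum_(i < d) z i 0 ^+ 2 = (z^T *m z) 0 0.
  by rewrite mxE; apply: eq_bigr => i _; rewrite mxE expr2.
by move=> hM; rewrite /enorm !dotE trmx_mul mulmxA -(mulmxA x^T) hM mulmx1.
Qed.

End EuclideanNorm.

(** * Words and similarities *)

Section Words.
Context {R : realType} {d : nat} {Phi : sim_seq R d}.
Implicit Types w v : symb Phi.

Lemma rho0 w : rho w 0 = 1.
Proof. by rewrite /rho big_ord0. Qed.

Lemma rhoS w n : rho w n.+1 = rho w n * contr (w n).
Proof. by rewrite /rho big_ord_recr. Qed.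

Lemma rho_gt0 w n : 0 < rho w n.
Proof. by apply: prodr_gt0 => k _; exact: contr_gt0. Qed.

Lemma rho_anti w : {homo rho w : m n / (m <= n)%N >-> n <= m}.
Proof.
move=> m n /subnK <-; elim: (n - m)%N => // k ih; rewrite addSn rhoS.
by rewrite (le_trans _ ih)// ler_piMr ?(ltW (rho_gt0 _ _))// ltW ?contr_lt1.
Qed.

Lemma rho_le1 w n : rho w n <= 1.
Proof. by rewrite -(rho0 w) rho_anti. Qed.

Lemma cylinder_le w v m n : (m <= n)%N -> cylinder w n v -> cylinder w m v.
Proof. by move=> mn h k km; apply: h; apply: leq_trans mn. Qed.

Lemma cylinderS w v n : cylinder w n v -> v n = w n -> cylinder w n.+1 v.
Proof.
by move=> h e k; rewrite ltnS leq_eqVlt => /predU1P[->//|]; exact: h.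
Qed.

Lemma cylinder_rho w v n : cylinder w n v -> rho v n = rho w n.
Proof. by move=> h; apply: eq_bigr => k _; rewrite h. Qed.

Lemma cylinder_scomp w v n : cylinder w n v -> scomp v n = scomp w n.
Proof.
elim: n => // n ih h; rewrite /= ih ?h//.
exact: cylinder_le h.
Qed.

Lemma cylinder_dfwith w n j : cylinder w n (dfwith w n j : symb Phi).
Proof. by move=> k kn; rewrite dfwithout// gtn_eqF. Qed.

Lemma sim_dist n (j : idx Phi n) x y :
  enorm (sim j x - sim j y) = contr j * enorm (x - y).
Proof.
rewrite /sim opprD addrACA subrr addr0 -scalerBr -mulmxBr.
rewrite enormZ ?enorm_orthogonal//; first exact: orth_orthogonal.
exact/ltW/contr_gt0.
Qed.

Lemma scomp_dist w n x y :
  enorm (scomp w n x - scomp w n y) = rho w n * enorm (x - y).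
Proof.
elim: n x y => [|n ih] x y; first by rewrite rho0 mul1r.
by rewrite /= ih sim_dist rhoS mulrA.
Qed.

Lemma scomp_continuous w n : continuous (scomp w n).
Proof.
move=> x; apply/(@cvgrPdist_lt _ _ _ (nbhs x) (nbhs_filter x)) => e e0.
apply/nbhs_ballP.
(* Using [d.+1] instead of [d] keeps the constant invertible when [d] is 0. *)
have dp : 0 < (d.+1%:R : R) by rewrite ltr0n.
exists (d.+1%:R^-1 * e); first by rewrite /= mulr_gt0// invr_gt0.
move=> y; rewrite -ball_normE /= => xy.
apply: le_lt_trans (normr_le_enorm _) _; rewrite scomp_dist.
apply: (@le_lt_trans _ _ (d.+1%:R * `|x - y|)); last first.
  by rewrite -ltr_pdivlMl.
apply: (@le_trans _ _ (d%:R * `|x - y|)); last by rewrite ler_wpM2r// ler_nat.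
by apply: le_trans (enorm_le_normr _); rewrite ler_piMl ?enorm_ge0 ?rho_le1.
Qed.

Context {X : set 'cV[R]_d} (hX : is_nifs Phi X).

Lemma scomp_subset w m n : (m <= n)%N -> scomp w n @` X `<=` scomp w m @` X.
Proof.
case: hX => _ _ XX _ /subnK <-; elim: (n - m)%N => // k ih.
apply: subset_trans ih => _ [x Xx <-]; rewrite addSn/=.
by exists (sim (w (k + m)%N) x) => //; apply: (XX); exists x.
Qed.

Lemma coding_scomp w n : (scomp w n @` X) (coding X w).
Proof.
suff h : (\bigcap_(k in [set k | (1 <= k)%N]) (scomp w k @` X)) (coding X w).
  by apply: (@scomp_subset w n n.+1) => //; exact: h.
apply: getPex; case: (hX) => -[x0 Xx0] cX XX _.
pose u n := scomp w n x0.
have su k l : (k <= l)%N -> (scomp w k @` X) (u l).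
  by move=> kl; apply: (@scomp_subset w k l) => //; exists x0.
have [|p [_ clp]] := cX (u @ \oo) _.
  by exists 0%N => // k _ /=; have [y Xy <-] := su 0%N k (leq0n k).
exists p => k _.
have cK : closed (scomp w k @` X).
  apply: compact_closed; first exact: norm_hausdorff.
  apply: continuous_compact => //.
  exact/continuous_subspaceT/scomp_continuous.
apply: cK => B /clp; apply.
by exists k => // l /= kl; exact: su.
Qed.
End Words.

(** * Bounded neighbourhood condition *)

Lemma card_le_fibers {I G : finType} (f : I -> G) (M : nat) :
  (forall g, #|[pred i | f i == g]| <= M)%N -> (#|I| <= #|G| * M)%N.
Proof.
move=> h; rewrite -sum1_card (partition_big f predT)//= -sum_nat_const.
by apply: leq_sum => g _; rewrite sum1_card; exact: h.
Qed.

Lemma card_le_counting {R : realType} {I : finType} {T : choiceType} (f : I -> T)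
    (A : set T) (y : R) :
  injective f -> (forall i, A (f i)) -> (counting A <= y%:E)%E -> #|I|%:R <= y.
Proof.
move=> finj fA; rewrite /counting; case: asboolP => // fin.
rewrite lee_fin; apply: le_trans; rewrite ler_nat cardE -(size_map f).
apply: uniq_leq_size; first by rewrite map_inj_uniq ?enum_uniq.
by move=> t /mapP[i _ ->]; rewrite in_fset_set// inE; exact: fA.
Qed.

(** What matters is that the index set [G] is chosen before [x] and [r]: the number of balls of
    radius r/2 covering a ball of radius cr depends only on c and d. *)
Lemma grid_cover {R : realType} (d : nat) (c : R) : 0 <= c ->
  exists G : finType, forall (x : 'cV[R]_d) (r : R), 0 < r ->
  exists y : G -> 'cV[R]_d, forall z,
    enorm (x - z) <= c * r -> exists g, enorm (y g - z) <= r / 2.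
Proof.
move=> c0; set L := (Num.truncn (4 * c * d.+1%:R)).+1.
exists {ffun 'I_d -> 'I_L} => x r r0.
(* With this mesh a grid cell has Euclidean diameter at most d h, hence at most r/2, and 2cr is
   4c(d+1) meshes. *)
pose h := r / (2 * d.+1%:R).
have d0 : 0 < (d.+1%:R : R) by rewrite ltr0n.
have h0 : 0 < h by rewrite divr_gt0// mulr_gt0.
exists (fun g : {ffun 'I_d -> 'I_L} =>
  \col_i (x i 0 - c * r + (g i : nat)%:R * h)) => z xz.
have zi i : 0 <= (z i 0 - x i 0 + c * r) / h <= 4 * c * d.+1%:R.
  have := le_trans (coord_le_enorm _ i) xz; rewrite !mxE ler_norml => /andP[a b].
  apply/andP; split; first by apply: divr_ge0; [lra|exact: ltW].
  rewrite ler_pdivrMr//.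
  have -> : 4 * c * d.+1%:R * h = 2 * (c * r).
    by rewrite /h; field; rewrite gt_eqF//.
  lra.
pose k i := Num.truncn ((z i 0 - x i 0 + c * r) / h).
have kL i : (k i < L)%N.
  by rewrite ltnS; apply: le_truncn; case/andP: (zi i).
exists [ffun i => Ordinal (kL i)].
apply: (@le_trans _ _ (d%:R * h)).
  apply: enorm_le_coord => [|i]; first exact: ltW.
  rewrite !mxE ffunE /=.
  have /andP[z0 _] := zi i; have /andP[] := truncn_itv z0; rewrite -/(k i).
  rewrite ler_pdivlMr// ltr_pdivrMr// -natr1 => a b.
  by rewrite ler_norml; apply/andP; split; lra.
have -> : r / 2 = d.+1%:R * h by rewrite /h; field; rewrite gt_eqF.
by rewrite ler_wpM2r ?ltW// ltr_nat.
Qed.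

(** * Separated families of words with nearby codings *)

Section Separation.
Context {R : realType} {d : nat} {Phi : sim_seq R d} {X : set 'cV[R]_d}.
Hypotheses (hX : is_nifs Phi X) (hbnc : bounded_neighbourhood Phi X).
Implicit Types w v : symb Phi.

Lemma diameter_bound :
  exists2 D : R, 1 <= D & forall x y, X x -> X y -> enorm (x - y) <= D.
Proof.
case: hX => _ /compact_bounded[M [_ hM]] _ _.
have h x : X x -> `|x| <= `|M| + 1.
  by apply: hM; rewrite (le_lt_trans (ler_norm _))// ltrDl.
exists (1 + d%:R * ((`|M| + 1) + (`|M| + 1))).
  by rewrite lerDl mulr_ge0// !addr_ge0.
move=> x y /h hx /h hy; apply: le_trans (enorm_le_normr _) _.
apply: ler_wpDl => //; rewrite ler_wpM2l//.
by apply: le_trans (ler_normB _ _) _; exact: lerD.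
Qed.

Lemma coding_dist : exists2 D : R, 1 <= D &
  forall w n p, (scomp w n @` X) p -> enorm (coding X w - p) <= D * rho w n.
Proof.
have [D D1 hD] := diameter_bound; exists D => // w n p [x Xx <-].
have [y Xy <-] := coding_scomp hX w n.
by rewrite scomp_dist mulrC ler_wpM2r ?hD// ltW ?rho_gt0.
Qed.

Lemma coding_scomp_cylinder w v n : cylinder w n v -> (scomp w n @` X) (coding X v).
Proof. by move=> /cylinder_scomp <-; exact: coding_scomp. Qed.

Lemma coding_limit_set w : limit_set Phi X (coding X w).
Proof. by move=> n _; exists w => //; exact: coding_scomp. Qed.

Lemma rho_uniformly_small (e : R) : 0 < e ->
  exists N, forall n, (N <= n)%N -> forall w, rho w n <= e.
Proof.
move=> e0; case: hX => _ _ _ /cvgrPdist_le/(_ _ e0)[N _ hN].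
exists N => n Nn w; have := hN n Nn; rewrite sub0r normrN => /(le_trans (ler_norm _)).
apply: le_trans; apply: ub_le_sup; last by exists w.
by exists 1 => _ [v _ <-]; exact: rho_le1.
Qed.

Lemma cut_exists w (r : R) : 0 < r -> r < 1 ->
  exists n, rho w n.+1 <= r < rho w n.
Proof.
move=> r0 r1; have [N hN] := rho_uniformly_small _ r0.
have ex : exists n, rho w n <= r by exists N; exact: hN.
case: (ex_minnP ex) => -[|n] hn min_n; first by move: hn; rewrite rho0 leNgt r1.
exists n; rewrite hn ltNge; apply/negP => /min_n; by rewrite ltnn.
Qed.

(** The form in which the hypothesis is used: a finite limsup gives one bound for all small scales,
    read on injective finite families of cylinders. *)
Lemma bounded_neighbourhood_family : exists M : nat, exists2 e : R, 0 < e &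
  forall r x, 0 < r -> r < e -> limit_set Phi X x ->
  forall (I : finType) (Q : I -> set (symb Phi)), injective Q ->
    (forall i, neighbours X x r (Q i)) -> (#|I| <= M)%N.
Proof.
move: hbnc; rewrite /bounded_neighbourhood limf_esupE => /ereal_inf_lt[_ [V V0 <-]].
set B := (X in (X < _)%E) => By.
have [y hy] : exists y : R, (B <= y%:E)%E.
  by case: (B) By => [y _| //|_]; [exists y | exists 0; exact: leNye].
have [e /= e0 he] := V0.
exists (Num.truncn y), e => // r x r0 re Kx I Q Qinj hQ.
rewrite -(ler_nat R).
have /le_truncn : (#|I|%:R : R) <= y; last by rewrite natrK ler_nat.
apply: (card_le_counting Q _ y Qinj hQ); apply: le_trans hy.
apply: (@le_trans _ _ (ereal_sup [set (counting (neighbours X x r) : \bar R)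
    | x in limit_set Phi X])).
  by apply: ereal_sup_ubound; exists x.
apply: ereal_sup_ubound; exists r => //; apply: he => //=.
by rewrite sub0r normrN gtr0_norm.
Qed.

(* Any two of the words differ at a level before they are cut at scale [r], so
   the cylinders of T(r) containing them are distinct. *)
Definition word_separated {I : Type} (r : R) (v : I -> symb Phi) :=
  forall i j, i <> j ->
  exists k, [/\ v i k != v j k, r < rho (v i) k & r < rho (v j) k].

(** The ball has any centre and radius cr, while [neighbours] asks for a centre in K and radius r.
    Cutting it into balls of radius r/2 and recentring each at a coding that it contains closes the
    gap. Separation makes the cylinders of T(r) distinct. *)
Lemma separated_family_bound (c : R) : 0 <= c ->
  exists M : nat, exists2 e : R, 0 < e < 1 &
  forall (r : R) (x : 'cV[R]_d), 0 < r -> r < e ->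
  forall (I : finType) (v : I -> symb Phi), word_separated r v ->
    (forall i, enorm (x - coding X (v i)) <= c * r) -> (#|I| <= M)%N.
Proof.
move=> c0; have [G hG] := grid_cover d c c0.
have [M [e e0 hM]] := bounded_neighbourhood_family.
(* The bound 1/2 keeps [r] below 1, as [cut_exists] requires. *)
exists (#|G| * M)%N, (Num.min e 2^-1).
  by rewrite lt_min e0 invr_gt0 ltr0n/= gt_min invf_lt1 ?ltr1n ?orbT.
move=> r x r0; rewrite lt_min => /andP[re r2] I v sep vx.
have r1 : r < 1 by apply: lt_trans r2 _; rewrite invf_lt1 ?ltr1n.
have [y hy] := hG x r r0.
have [f hf] := choice (fun i => hy _ (vx i)).
have [n hn] := choice (fun i => cut_exists (v i) _ r0 r1).
apply: (@card_le_fibers _ _ f) => g.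
have [i0 /= i0g|no] := pickP [pred i | f i == g]; last first.
  by rewrite (eq_card no) card0.
rewrite -card_sig; apply: (hM r (coding X (v i0)) r0 re (coding_limit_set _) _
  (fun i : {i | f i == g} => cylinder (v (val i)) (n (val i)).+1)) => [i j eqQ|i].
  apply: val_inj; apply: contrapT => ne.
  have [k [/eqP vk rk _]] := sep _ _ ne; apply: vk.
  (* The separating level [k] lies before the cut, because [rho] still exceeds [r] there; so equal
     cylinders would force equal letters at [k]. *)
  have cyl : cylinder (v (val i)) (n (val i)).+1 (v (val j)) by rewrite eqQ.
  rewrite cyl// ltnNge; apply/negP => /(rho_anti (v (val i))) h.
  have /andP[h' _] := hn (val i).
  by have := lt_le_trans rk (le_trans h h'); rewrite ltxx.
split; first by exists (v (val i)), (n (val i)).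
exists (coding X (v (val i))); split; first by exists (v (val i)).
rewrite /eball /closed_ball_ /=; apply: le_trans (enorm_dist_trans (y (f i0)) _ _) _.
rewrite enormB; have := hf i0; have := hf (val i).
rewrite (eqP (valP i)) (eqP i0g); lra.
Qed.
End Separation.

Lemma prodr_powR {R : realType} {I : finType} (F : I -> R) (t : R) :
  (forall i, 0 <= F i) -> \prod_i F i `^ t = (\prod_i F i) `^ t.
Proof.
move=> F0; suff [] : \prod_i F i `^ t = (\prod_i F i) `^ t /\ 0 <= \prod_i F i by [].
elim/big_rec2: _ => [|i x y _ [-> y0]]; first by rewrite powR1.
by rewrite powRM// mulr_ge0.
Qed.

(** * Extensions of a word and block sums *)

Section Extension.
Context {R : realType} {d : nat} {Phi : sim_seq R d}.
Implicit Types w v : symb Phi.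

Lemma word_extension w n m (j : forall k : 'I_m, idx Phi (n + k)) :
  exists v : symb Phi, cylinder w n v /\ forall k : 'I_m, v (n + k)%N = j k.
Proof.
elim: m j => [|m ih] j; first by exists w; split => // -[].
have [v [wv vj]] := ih (fun k => j (widen_ord (leqnSn m) k)).
exists (dfwith v (n + m)%N (j ord_max)); split=> [k kn|k].
  by rewrite dfwithout ?wv// gtn_eqF// ltn_addr.
have [/= km|] := ltnP k m.
  have -> : k = widen_ord (leqnSn m) (Ordinal km) by exact: val_inj.
  by rewrite -vj dfwithout// eqn_add2l gtn_eqF.
move=> mk; have -> : k = ord_max.
  by apply: val_inj; apply/eqP; rewrite eqn_leq mk -ltnS ltn_ord.
exact: dfwithin.
Qed.

Lemma rho_extension w v n m (j : forall k : 'I_m, idx Phi (n + k)) :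
  cylinder w n v -> (forall k : 'I_m, v (n + k)%N = j k) ->
  rho v (n + m) = rho w n * \prod_(k < m) contr (j k).
Proof.
move=> wv vj; rewrite /rho big_split_ord /=; congr (_ * _).
  by apply: eq_bigr => k _; rewrite wv//=.
by apply: eq_bigr => k _; rewrite vj.
Qed.

(* Finite words are represented by extensions [v j] of a fixed [w], so that
   bounds on [rho] apply to them. *)
Lemma block_sum_words w n m :
  exists v : {dffun forall k : 'I_m, idx Phi (n + k)} -> symb Phi,
  [/\ forall j, cylinder w n (v j),
      forall j (k : 'I_m), v j (n + k)%N = j k
    & forall t, block_sum Phi n m t = \sum_j (rho (v j) (n + m) / rho w n) `^ t].
Proof.
have [v hv] := choice (fun j : {dffun forall k : 'I_m, idx Phi (n + k)} =>
  @word_extension w n m j).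
exists v; split => [j|j k|t]; [exact: (hv j).1|exact: (hv j).2|].
rewrite block_sumE; apply: eq_bigr => j _.
rewrite (rho_extension _ _ _ _ _ (hv j).1 (hv j).2) mulrAC divff ?gt_eqF ?rho_gt0//.
by rewrite mul1r prodr_powR// => k; exact/ltW/contr_gt0.
Qed.
End Extension.

(** * Bounded alphabets and uniform geometric contraction *)

Section Contraction.
Context {R : realType} {d : nat} {Phi : sim_seq R d} {X : set 'cV[R]_d}.
Hypotheses (hX : is_nifs Phi X) (hbnc : bounded_neighbourhood Phi X).
Implicit Types w v : symb Phi.

Lemma other_letter n (a : idx Phi n) : exists b, b != a.
Proof.
have : (0 < #|predC1 a|)%N.
  by rewrite cardC1 -ltnS prednK ?idx_card// (ltn_trans _ (idx_card _ _)).
by case/card_gt0P => b; exists b.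
Qed.

(* The words branching off [w] from level [n] on are separated at scale
   [rho w n / 2], and their codings lie in one ball of comparable radius. *)
Lemma branching_bound : exists M N : nat, forall w n, (N <= n)%N ->
  (#|idx Phi n| <= M)%N /\ forall k, rho w n / 2 < rho w (n + k) -> (k <= M)%N.
Proof.
have [D D1 hD] := coding_dist hX.
have D0 : 0 <= D by apply: le_trans D1.
have [M [e /andP[e0 _] hM]] :=
  separated_family_bound hX hbnc (2 * D) (mulr_ge0 (ler0n _ 2) D0).
have [N hN] := rho_uniformly_small hX _ e0.
exists M, N => w n Nn.
have r0 : 0 < rho w n / 2 by rewrite divr_gt0 ?rho_gt0.
have re : rho w n / 2 < e.
  by apply: lt_le_trans (hN n Nn w); rewrite ltr_pdivrMr// ltr_pMr ?rho_gt0// ltr1n.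
have near v : cylinder w n v ->
    enorm (coding X w - coding X v) <= 2 * D * (rho w n / 2).
  move=> wv; have -> : 2 * D * (rho w n / 2) = D * rho w n by field.
  by apply: hD; exact: coding_scomp_cylinder.
split.
  apply: (hM _ (coding X w) r0 re _ (fun j => dfwith w n j)) => [i j ij|i].
    have rl l : rho w n / 2 < rho (dfwith w n l : symb Phi) n.
      rewrite (cylinder_rho _ _ _ (cylinder_dfwith _ _ _)).
      by rewrite ltr_pdivrMr// ltr_pMr ?rho_gt0// ltr1n.
    by exists n; rewrite !dfwithin; split; first exact/eqP.
  exact/near/cylinder_dfwith.
move=> k hk; rewrite -[k]card_ord.
(* The word [v i] follows [w] up to level n + i and leaves it there. Two such words are separated at
   the smaller of their branching levels, so there are at most [M] of them. *)
pose b (i : 'I_k) := xchoose (other_letter _ (w (n + i)%N)).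
have hb (i : 'I_k) : b i != w (n + i)%N := xchooseP (other_letter _ (w (n + i)%N)).
pose v (i : 'I_k) : symb Phi := dfwith w (n + i)%N (b i).
have vw (i : 'I_k) : cylinder w (n + i) (v i) by exact: cylinder_dfwith.
have key (i j : 'I_k) : (i < j)%N -> [/\ v i (n + i)%N != v j (n + i)%N,
    rho w n / 2 < rho (v i) (n + i) & rho w n / 2 < rho (v j) (n + i)].
  move=> ij; have vjw : cylinder w (n + i) (v j).
    by apply: cylinder_le (vw j); rewrite leq_add2l ltnW.
  rewrite (cylinder_rho _ _ _ (vw i)) (cylinder_rho _ _ _ vjw).
  have ri : rho w n / 2 < rho w (n + i).
    by apply: lt_le_trans hk _; apply: rho_anti; rewrite leq_add2l ltnW.
  by split => //; rewrite [v i _]dfwithin (vw j) ?ltn_add2l// hb.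
apply: (hM _ (coding X w) r0 re _ v) => [i j ij|i].
  have [lij|lji|eij] := ltngtP i j.
  - by exists (n + i)%N; exact: key.
  - by have [h1 h2 h3] := key _ _ lji; exists (n + j)%N; split=> //; rewrite eq_sym.
  - by case: ij; exact: val_inj.
by apply/near/cylinder_le/vw; rewrite leq_addr.
Qed.

Lemma card_idx_bounded : exists A : nat, forall n, (#|idx Phi n| <= A)%N.
Proof.
have [M [N hM]] := branching_bound.
exists (M + \sum_(k < N) #|idx Phi k|)%N => n.
have [Nn|nN] := leqP N n.
  have [h _] := hM (fun n => idx_inhabited Phi n) n Nn.
  exact: leq_trans h (leq_addr _ _).
rewrite (bigD1 (Ordinal nN))//= addnCA; exact: leq_addr.
Qed.

(** By [branching_bound], [rho] halves within M + 1 levels once the level is at least N, hence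
    within H = N + M + 1 levels from anywhere. So kappa is the H-th root of 1/2, and the factor 2
    pays for the last incomplete block of fewer than H levels. *)
Lemma geometric_contraction : exists2 kappa : R, 0 < kappa < 1 &
  forall w n l, rho w (n + l) <= 2 * kappa ^+ l * rho w n.
Proof.
have [M [N hM]] := branching_bound.
pose H := (N + M.+1)%N.
have half w n : rho w (n + H) <= 2^-1 * rho w n.
  rewrite addnA; have [|_ h] := hM w (n + N)%N; first exact: leq_addl.
  apply: (@le_trans _ _ (2^-1 * rho w (n + N))); last first.
    by rewrite ler_wpM2l ?invr_ge0//; apply: rho_anti; rewrite leq_addr.
  by rewrite leNgt mulrC; apply/negP => /h; rewrite ltnn.
have H0 : (H%:R : R) != 0 by rewrite pnatr_eq0 /H addnS.
pose kappa : R := 2^-1 `^ H%:R^-1.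
have k0 : 0 < kappa by rewrite powR_gt0// invr_gt0.
have kH : kappa ^+ H = 2^-1.
  by rewrite -powR_mulrn ?ltW// -powRrM mulVf// powRr1// invr_ge0.
have k1 : kappa < 1.
  rewrite ltNge; apply/negP => /(exprn_ege1 H); rewrite kH leNgt invf_lt1//.
  by rewrite ltr1n.
exists kappa; first by rewrite k0.
move=> w n l; elim/ltn_ind: l n => l ih n; have [lH|Hl] := ltnP l H.
  apply: le_trans (rho_anti w _ _ (leq_addr _ _)) _.
  have kl : 2^-1 <= kappa ^+ l.
    by rewrite -kH; apply: ler_wiXn2l; [exact: ltW|exact: ltW|exact: ltnW].
  rewrite -[leLHS]mul1r ler_wpM2r ?(ltW (rho_gt0 _ _))//; lra.
rewrite -(subnKC Hl) addnA.
apply: le_trans (ih (l - H)%N _ (n + H)%N) _.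
  by rewrite ltn_subrL (leq_trans _ Hl) /H addnS.
apply: le_trans (ler_wpM2l _ (half w n)) _.
  by rewrite mulr_ge0// exprn_ge0// ltW.
rewrite exprD kH le_eqVlt; apply/orP; left; apply/eqP; ring.
Qed.

End Contraction.

(** * Lower bound for the dimension *)

Lemma exprn_eventually_small {R : realType} (B q : R) : 0 <= q < 1 ->
  exists m0, forall m, (m0 <= m)%N -> B * q ^+ m <= 1.
Proof.
move=> /andP[q0 q1].
have /cvgrPdist_le/(_ _ ltr01)[m0 _ h] : (fun m => B * q ^+ m) @ \oo --> (0 : R).
  rewrite -[X in _ --> X](mulr0 B); apply: cvgMr.
  by apply: cvg_expr; rewrite ger0_norm.
exists m0 => m /h /=; rewrite sub0r normrN; exact/le_trans/ler_norm.
Qed.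

Lemma sum_exprn_le {R : realFieldType} (q : R) n : 0 <= q < 1 ->
  \sum_(k < n) q ^+ k <= (1 - q)^-1.
Proof.
move=> /andP[q0 q1]; rewrite -[leRHS]mul1r ler_pdivlMr ?subr_gt0//.
have := subrX1 q n; have := exprn_ge0 n q0; lra.
Qed.

Lemma powR_lt1 {R : realType} (a e : R) : 0 <= a -> a < 1 -> 0 < e -> a `^ e < 1.
Proof.
move=> a0 a1 e0; have -> : 1 = 1 `^ e :> R by rewrite powR1.
by apply: gt0_ltr_powR; rewrite ?nnegrE.
Qed.

Lemma powRV {R : realType} (a e : R) : 0 <= a -> a^-1 `^ e = (a `^ e)^-1.
Proof. by move=> a0; rewrite -powR_inv1// powRAC powR_inv1 ?powR_ge0. Qed.

Lemma powRX {R : realType} (a e : R) n : 0 <= a -> (a ^+ n) `^ e = (a `^ e) ^+ n.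
Proof.
move=> a0; rewrite -(powR_mulrn n a0) -(powR_mulrn n (powR_ge0 a e)).
exact: powRAC.
Qed.

(* The sum is cut into the dyadic shells [x0 2^-(k+1) < x i <= x0 2^-k]. *)
Lemma sum_powR_le_distribution {R : realType} (C s t : R) :
  0 <= C -> 0 <= s -> s < t ->
  exists2 K : R, 0 <= K & forall (I : finType) (x : I -> R) (x0 : R), 0 < x0 ->
    (forall i, 0 < x i <= x0) ->
    (forall u, 0 < u -> #|[pred i | u < x i]|%:R <= C * u `^ (- s)) ->
    \sum_i x i `^ t <= K * x0 `^ (t - s).
Proof.
move=> C0 s0 st; pose q : R := 2^-1 `^ (t - s).
have q01 : 0 <= q < 1.
  by rewrite powR_ge0 powR_lt1 ?subr_gt0 ?invr_ge0 ?invf_lt1 ?ltr1n.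
exists (C * 2 `^ s / (1 - q)).
  apply: divr_ge0; first by rewrite mulr_ge0 ?powR_ge0.
  by rewrite subr_ge0 ltW//; case/andP: q01.
move=> I x x0 x0p hx hC.
have shells N : \sum_(i | x0 * 2^-1 ^+ N < x i) x i `^ t
    <= C * 2 `^ s * x0 `^ (t - s) * \sum_(k < N) q ^+ k.
  elim: N => [|N ih].
    rewrite big_ord0 mulr0 big_pred0// => i; rewrite expr0 mulr1.
    by apply/negbTE; rewrite -leNgt; case/andP: (hx i).
  set h := x0 * 2^-1 ^+ N in ih.
  have h0 : 0 < h by rewrite mulr_gt0// exprn_gt0// invr_gt0.
  have hN : h `^ (t - s) = x0 `^ (t - s) * q ^+ N.
    rewrite /h powRM ?exprn_ge0 ?invr_ge0 ?ltW//; congr (_ * _).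
    by rewrite powRX ?invr_ge0.
  rewrite big_ord_recr/= mulrDr (bigID (fun i => h < x i))/=.
  apply: lerD.
    apply: le_trans ih; rewrite le_eqVlt; apply/orP; left; apply/eqP.
    apply: eq_bigl => i; apply: andb_idl; apply: le_lt_trans.
    rewrite /h exprSr mulrA ler_piMr ?ltW//.
    by rewrite invf_lt1 ?ltr1n.
  set h' := x0 * 2^-1 ^+ N.+1.
  have h'E : h' = h / 2 by rewrite /h' exprSr mulrA.
  have h'0 : 0 < h' by rewrite h'E divr_gt0.
  apply: (@le_trans _ _ (\sum_(i | h' < x i) h `^ t)).
    rewrite [leRHS](bigID (fun i => h < x i))/= -[leLHS]add0r.
    apply: lerD; first by apply: sumr_ge0 => i _; exact: powR_ge0.
    apply: ler_sum => i /andP[_]; rewrite -leNgt => xh.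
    have /andP[xi0 _] := hx i.
    by apply: ge0_ler_powR; rewrite ?nnegrE ?(ltW xi0) ?(ltW h0)// (le_trans s0)// ltW.
  rewrite sumr_const -[leLHS]mulr_natl.
  apply: le_trans (ler_wpM2r (powR_ge0 _ _) (hC _ h'0)) _.
  rewrite h'E powRM ?invr_ge0 ?(ltW h0)//.
  have -> : 2^-1 `^ (- s) = 2 `^ s :> R.
    by rewrite powRV// powRN invrK.
  rewrite -[X in _ <= X]mulrA -hN powRB ?gt_eqF ?implybT// powRN.
  rewrite le_eqVlt; apply/orP; left; apply/eqP; ring.
have [N hN] : exists N, forall i, x0 * 2^-1 ^+ N < x i.
  (* As 1 + S exceeds every 1/x_i, the choice x0 (1 + S) 2^-N <= 1 puts x0 2^-N below all the x_i,
     so finitely many shells exhaust the family. *)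
  pose S := \sum_i (x i)^-1.
  have [|N hN] := exprn_eventually_small (x0 * (1 + S)) (2^-1 : R).
    by rewrite invr_ge0 ler0n invf_lt1 ?ltr1n.
  exists N => i; have /andP[xi _] := hx i.
  have iS : (x i)^-1 < 1 + S.
    rewrite ltr_pwDl// /S (bigD1 i)//= lerDl.
    by apply: sumr_ge0 => j _; rewrite invr_ge0 ltW//; case/andP: (hx j).
  have p0 : 0 < x0 * 2^-1 ^+ N by rewrite mulr_gt0// exprn_gt0// invr_gt0.
  have := hN N (leqnn N); rewrite mulrAC; apply: contra_leT; rewrite -leNgt => xi'.
  rewrite -[ltLHS](mulfV (lt0r_neq0 xi)).
  by apply: (le_lt_trans (ler_wpM2r _ xi')); rewrite ?invr_ge0 ?(ltW xi)// ltr_pM2l.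
have := shells N; rewrite (eq_bigl xpredT); last by move=> i; rewrite hN.
move=> /le_trans; apply.
rewrite -!mulrA ler_wpM2l// ler_wpM2l ?powR_ge0// mulrC ler_wpM2r ?powR_ge0//.
exact: sum_exprn_le.
Qed.

Section LowerBound.
Context {R : realType} {d : nat} {Phi : sim_seq R d} {X : set 'cV[R]_d}.
Hypotheses (hX : is_nifs Phi X) (hbnc : bounded_neighbourhood Phi X).
Implicit Types w v : symb Phi.

Definition assouad_bound (K : set 'cV[R]_d) (C s : R) :=
  forall r rr : R, 0 < r -> r <= rr -> rr < 1 -> forall x, K x ->
    (cover_number (eball x rr `&` K) r <= (C * (rr / r) `^ s)%:E)%E.

(** The extensions counted are separated at scale q = u rho(w), and their codings lie in the ball of
    radius D rho(w) about the coding of w. The Assouad bound covers the part of K in that ball by at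
    most 2C(D/u)^s balls of radius q, each containing at most [M] of the codings. Taking n >= N
    makes the radii small enough for both facts. *)
Lemma word_distribution (C s : R) :
  0 < C -> 0 <= s -> assouad_bound (limit_set Phi X) C s ->
  exists2 C' : R, 0 <= C' & exists N : nat,
  forall w n m (v : {dffun forall k : 'I_m, idx Phi (n + k)} -> symb Phi) u,
    (N <= n)%N ->  (forall j, cylinder w n (v j)) ->
    (forall j (k : 'I_m), v j (n + k)%N = j k) -> 0 < u ->
    #|[pred j | u < rho (v j) (n + m) / rho w n]|%:R <= C' * u `^ (- s).
Proof.
move=> C0 s0 hC; have [D D1 hD] := coding_dist hX.
have D0 : 0 < D by apply: lt_le_trans D1.
have [M [e /andP[e0 _] hM]] := separated_family_bound hX hbnc 1 ler01.
have m0 : 0 < Num.min e (2 * D)^-1 by rewrite lt_min e0 invr_gt0 mulr_gt0.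
have [N hN] := rho_uniformly_small hX _ m0.
exists (2 * C * D `^ s * M%:R); first by rewrite !mulr_ge0 ?powR_ge0// ltW.
exists N => w n m v u Nn wv vj u0.
have := hN n Nn w; rewrite le_min => /andP[we wD].
have rw := rho_gt0 w n.
have [u1|u1] := leP 1 u.
  rewrite eq_card0 ?mulr_ge0 ?powR_ge0 ?(ltW C0)// => j; rewrite inE.
  apply/negbTE; rewrite -leNgt (le_trans _ u1)// ler_pdivrMr// mul1r.
  by rewrite -(cylinder_rho _ _ _ (wv j)) rho_anti ?leq_addr.
set q := u * rho w n.
have q0 : 0 < q by rewrite mulr_gt0.
have qw : q < rho w n by rewrite gtr_pMl.
have wDw : rho w n <= D * rho w n by rewrite ler_peMl// ltW.
have D2 : D * rho w n < 1.
  by move: wD; rewrite invfM ler_pdivlMr// mulrC; lra.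
have := hC q (D * rho w n) q0 (le_trans (ltW qw) wDw) D2 _ (coding_limit_set hX w).
have -> : D * rho w n / q = D / u by rewrite /q; field; rewrite !gt_eqF.
set B := C * (D / u) `^ s.
have B0 : 0 < B by rewrite mulr_gt0 ?powR_gt0 ?divr_gt0.
(* The covering number is an infimum, so an actual cover is extracted from a strict inequality; this
   costs the factor 2. *)
have : (B%:E < (2 * B)%:E)%E by rewrite lte_fin; lra.
move=> /[swap] /le_lt_trans /[apply] /ereal_inf_lt[_ [k [c hc] <-]].
rewrite lte_fin => kB.
pose large (j : {dffun forall k : 'I_m, idx Phi (n + k)}) :=
  u < rho (v j) (n + m) / rho w n.
have cov (j : {j | large j}) :
    exists i, enorm (c i - coding X (v (val j))) <= q.
  have [] : (\bigcup_(i in [set: 'I_k]) eball (c i) q) (coding X (v (val j))).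
    apply: hc; split; last exact: coding_limit_set.
    by apply: hD; exact: coding_scomp_cylinder.
  by move=> i _ hi; exists i.
have [f hf] := choice cov.
have : (#|{: {j | large j}}| <= k * M)%N.
  rewrite -[X in (_ <= X * _)%N]card_ord; apply: (card_le_fibers f) => g.
  rewrite -card_sig; apply: (hM q (c g) q0 (lt_le_trans qw we) _
     (fun j : {j | f j == g} => v (val (val j)))) => [i j ij|j].
    (* Different blocks differ at some letter [l], and there [rho] is still above q because it is
       above q at the end of the block. *)
    have [l /eqP hl] : exists l, val (val i) l != val (val j) l.
      apply: contrapT => no; apply: ij; do 2 apply: val_inj; apply/ffunP => l.
      by apply: contrapT => /eqP hl; apply: no; exists l.
    have ql (a : {j | large j}) : q < rho (v (val a)) (n + l).
      have := valP a; rewrite /large ltr_pdivlMr// => /lt_le_trans; apply.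
      by apply: rho_anti; rewrite leq_add2l ltnW.
    by exists (n + l)%N; rewrite !vj; split; first exact/eqP.
  by rewrite mul1r; have := hf (val j); rewrite (eqP (valP j)).
rewrite card_sig -(ler_nat R) => /le_trans; apply; rewrite natrM.
apply: (@le_trans _ _ (2 * B * M%:R)); first by rewrite ler_wpM2r// ltW.
rewrite /B powRM ?invr_ge0 ?(ltW D0) ?(ltW u0)// powRV ?(ltW u0)// powRN le_eqVlt.
apply/orP; left; apply/eqP; ring.
Qed.

(** The dyadic estimate is applied to the ratios rho(v)/rho(w), whose common upper bound x0 = 2
    kappa^m supplies the geometric decay. *)
Lemma block_sum_decay_of_assouad (C s t : R) :
  0 < C -> 0 <= s -> s < t -> assouad_bound (limit_set Phi X) C s ->
  exists (N : nat) (K q : R), [/\ 0 <= K, 0 <= q < 1 &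
    forall n m, (N <= n)%N -> block_sum Phi n m t <= K * q ^+ m].
Proof.
move=> C0 s0 st hC; have [C' C'0 [N hN]] := word_distribution _ _ C0 s0 hC.
have [kappa /andP[k0 k1] hk] := geometric_contraction hX hbnc.
have [K K0 hK] := sum_powR_le_distribution C' s t C'0 s0 st.
have ts : 0 < t - s by rewrite subr_gt0.
exists N, (K * 2 `^ (t - s)), (kappa `^ (t - s)); split.
- by rewrite mulr_ge0 ?powR_ge0.
- by rewrite powR_ge0 powR_lt1// ltW.
move=> n m Nn; pose w : symb Phi := fun n => idx_inhabited Phi n.
have [v [wv vj ->]] := block_sum_words w n m.
have -> : K * 2 `^ (t - s) * (kappa `^ (t - s)) ^+ m = K * (2 * kappa ^+ m) `^ (t - s).
  by rewrite powRM ?exprn_ge0 ?(ltW k0)// powRX ?(ltW k0)// mulrA.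
apply: hK => [|j|u u0]; first by rewrite mulr_gt0// exprn_gt0.
  rewrite divr_gt0 ?rho_gt0//= ler_pdivrMr ?rho_gt0//.
  by rewrite -(cylinder_rho _ _ _ (wv j)) hk.
exact: hN.
Qed.

Lemma theta_eventually_le (C s t : R) :
  0 < C -> 0 <= s -> s < t -> assouad_bound (limit_set Phi X) C s ->
  exists m0, forall m, (m0 <= m)%N -> forall n, theta Phi n m <= t.
Proof.
move=> C0 s0 st hC.
have [N [K [q [K0 q01 hK]]]] := block_sum_decay_of_assouad _ _ _ C0 s0 st hC.
have [A hA] := card_idx_bounded hX hbnc.
(* The first [N] levels of a block contribute at most A^N; the other m - N levels start beyond [N],
   where the decay applies. *)
have [m1 hm1] := exprn_eventually_small (A%:R ^+ N * K) q q01.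
exists (N + m1).+1 => m m1m n.
have t0 : 0 <= t by rewrite (le_trans s0)// ltW.
apply: theta_le; first by apply: leq_trans m1m.
have Nm : (N <= m)%N by apply: leq_trans m1m; rewrite ltnW// ltnS leq_addr.
rewrite -(subnKC Nm) block_sumD.
have h1 := block_sum_le_expn Phi A N n N t t0 hA (leqnn N).
have h2 := hK (n + N)%N (m - N)%N (leq_addl _ _).
apply: le_trans (ler_pM _ _ h1 h2) _; try exact/ltW/block_sum_gt0.
rewrite mulrA; apply: hm1; rewrite leq_subRL// ltnW//.
Qed.

End LowerBound.

(** * Upper bound for the dimension *)

Section UpperBound.
Context {R : realType} {d : nat} {Phi : sim_seq R d} {X : set 'cV[R]_d}.
Hypotheses (hX : is_nifs Phi X) (hbnc : bounded_neighbourhood Phi X).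
Implicit Types w v : symb Phi.

(** Beyond level [N], blocks of length [m] are split off at cost at most 1 until at most [m] levels
    remain, which cost at most A^m; the initial [N] levels cost at most A^N. *)
Lemma block_sum_bounded (N m : nat) s : 0 <= s -> (0 < m)%N ->
  (forall n, (N <= n)%N -> block_sum Phi n m s <= 1) ->
  exists2 B : R, 0 <= B & forall n l, block_sum Phi n l s <= B.
Proof.
move=> s0 m0 hm; have [A hA] := card_idx_bounded hX hbnc.
have tail n l : (N <= n)%N -> block_sum Phi n l s <= A%:R ^+ m.
  elim/ltn_ind: l n => l ih n Nn; have [lm|ml] := leqP l m.
    exact: block_sum_le_expn.
  rewrite -(subnKC (ltnW ml)) block_sumD -[leRHS]mul1r.
  apply: ler_pM; [exact/ltW/block_sum_gt0|exact/ltW/block_sum_gt0|exact: hm|].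
  apply: ih; first by rewrite ltn_subrL m0 (leq_trans _ ml).
  by rewrite (leq_trans Nn)// leq_addr.
exists (A%:R ^+ (N + m)); first by rewrite exprn_ge0.
move=> n l; have [lN|Nl] := leqP l (N + m); first exact: block_sum_le_expn.
have Nl' : (N <= l)%N by rewrite (leq_trans _ (ltnW Nl))// leq_addr.
rewrite -(subnKC Nl') block_sumD exprD.
apply: ler_pM; [exact/ltW/block_sum_gt0|exact/ltW/block_sum_gt0| |].
  exact: block_sum_le_expn.
by apply: tail; rewrite leq_addl.
Qed.

(** Each ratio x = rho(v)/rho(w) is at most 2 kappa^l, so in x^t = x^s x^(t-s) the second factor
    decays uniformly. *)
Lemma block_sum_decay (B s t : R) : 0 <= B -> s < t ->
  (forall n l, block_sum Phi n l s <= B) ->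
  exists K q : R, [/\ 0 <= K, 0 <= q < 1 &
    forall n l, block_sum Phi n l t <= K * q ^+ l].
Proof.
move=> B0 st hB.
have [kappa /andP[k0 k1] hk] := geometric_contraction hX hbnc.
have ts : 0 < t - s by rewrite subr_gt0.
exists (B * 2 `^ (t - s)), (kappa `^ (t - s)); split.
- by rewrite mulr_ge0 ?powR_ge0.
- by rewrite powR_ge0 powR_lt1// ltW.
move=> n l; pose w : symb Phi := fun n => idx_inhabited Phi n.
have [v [wv _ vE]] := block_sum_words w n l.
rewrite -mulrA -powRX ?(ltW k0)// -powRM ?exprn_ge0 ?(ltW k0)//.
apply: (@le_trans _ _ (block_sum Phi n l s * (2 * kappa ^+ l) `^ (t - s))); last first.
  by rewrite ler_wpM2r ?powR_ge0.
rewrite !vE mulr_suml; apply: ler_sum => j _.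
have x0 : 0 < rho (v j) (n + l) / rho w n by rewrite divr_gt0 ?rho_gt0.
have powt x : 0 < x -> x `^ t = x `^ s * x `^ (t - s).
  by move=> xp; rewrite -powRD ?subrKC// (gt_eqF xp) implybT.
rewrite powt// ler_wpM2l ?powR_ge0//.
apply: ge0_ler_powR; rewrite ?nnegrE ?(ltW ts) ?(ltW x0)//.
  by rewrite mulr_ge0// exprn_ge0// ltW.
by rewrite ler_pdivrMr ?rho_gt0// -(cylinder_rho _ _ _ (wv j)) hk.
Qed.

(** Centres are kept in a list so that covers of several sets merge by concatenation and their sizes
    add. *)
Definition covered_by (A : set 'cV[R]_d) (r : R) (s : seq 'cV[R]_d) :=
  forall z, A z -> exists2 c, c \in s & enorm (c - z) <= r.

Lemma cover_number_le (A : set 'cV[R]_d) r s :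
  covered_by A r s -> (cover_number A r <= (size s)%:R%:E)%E.
Proof.
move=> hs; apply: ereal_inf_lbound; exists (size s) => //.
exists (fun i => nth 0 s i) => z /hs[c cs cz].
have ci : (index c s < size s)%N by rewrite index_mem.
by exists (Ordinal ci) => //; rewrite /eball /closed_ball_ /= nth_index.
Qed.

Lemma covered_by_flatten {I : finType} (A : I -> set 'cV[R]_d) r f :
  (forall i, covered_by (A i) r (f i)) ->
  covered_by (\bigcup_i A i) r (flatten [seq f i | i <- enum I]).
Proof.
move=> hf z [i _ /hf[c cf cz]]; exists c => //.
by apply/flattenP; exists (f i) => //; apply/map_f; rewrite mem_enum.
Qed.

Lemma size_flatten_enum {I : finType} {T : Type} (f : I -> seq T) :
  size (flatten [seq f i | i <- enum I]) = (\sum_i size (f i))%N.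
Proof. by rewrite size_flatten /shape -map_comp sumnE big_map big_enum. Qed.

(* [X] is not the union of the images [sim j @` X], so the covering induction
   is run on the points reached after [h] further levels. *)
Definition descendants w a h : set 'cV[R]_d :=
  [set y | exists2 v, cylinder w a v & (scomp v (a + h) @` X) y].

Lemma descendants_cover (D A r t : R) :
  0 < D -> 0 < r -> 0 <= t -> (forall n, #|idx Phi n|%:R <= A) ->
  (forall w n p, (scomp w n @` X) p -> enorm (coding X w - p) <= D * rho w n) ->
  forall h a w, (forall v, rho v (a + h) <= r) ->
  exists2 s, covered_by (descendants w a h) (D * r) s &
    (size s)%:R <= 1 + A * (\sum_(l < h) block_sum Phi a l t) * (rho w a / r) `^ t.
Proof.
move=> D0 r0 t0 hA hD.
have A0 : 0 <= A by apply: le_trans (hA 0%N).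
have base h a w : rho w a <= r ->
    covered_by (descendants w a h) (D * r) [:: coding X w].
  move=> wr z [v wv vz]; exists (coding X w); first by rewrite inE.
  apply: (@le_trans _ _ (D * rho w a)); last by rewrite ler_wpM2l// ltW.
  apply: hD; rewrite -(cylinder_scomp _ _ _ wv).
  by apply: (scomp_subset hX _ _ _ _ _ vz); rewrite leq_addr.
have b0 h a w : 0 <= A * (\sum_(l < h) block_sum Phi a l t) * (rho w a / r) `^ t.
  rewrite mulr_ge0 ?powR_ge0 ?mulr_ge0//.
  by apply: sumr_ge0 => l _; exact/ltW/block_sum_gt0.
elim=> [|h ih] a w hr.
  by exists [:: coding X w]; [apply: base; move: (hr w); rewrite addn0|rewrite lerDl].
have [wr|rw] := leP (rho w a) r.
  by exists [:: coding X w]; [exact: base|rewrite lerDl].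
pose wj j : symb Phi := dfwith w a j.
have hr' v : rho v (a.+1 + h) <= r by rewrite addSnnS.
have ihj j : exists s, covered_by (descendants (wj j) a.+1 h) (D * r) s /\
    (size s)%:R <= 1 + A * (\sum_(l < h) block_sum Phi a.+1 l t)
                         * (rho (wj j) a.+1 / r) `^ t.
  by have [s cs hs] := ih a.+1 (wj j) hr'; exists s.
have [f hf] := choice ihj.
exists (flatten [seq f j | j <- enum (idx Phi a)]).
  move=> z [v wv vz]; apply: (covered_by_flatten _ _ _ (fun j => (hf j).1)).
  exists (v a) => //; exists v; last by rewrite addSnnS.
  apply: cylinderS; last by rewrite [RHS]dfwithin.
  by move=> k ka; rewrite /wj dfwithout ?wv// gtn_eqF.
(* The children contribute one summand 1 each, at most A in all. Since rho(w,a) > r, this is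
   absorbed by the term l = 0 of the new sum; the sums of the children give the terms l >= 1. *)
have ge1 : 1 <= (rho w a / r) `^ t.
  rewrite -(powRr0 (rho w a / r)) ler_powR// ler_pdivlMr// mul1r ltW//.
set y := (rho w a / r) `^ t in ge1 *.
set S := \sum_(l < h) block_sum Phi a.+1 l t.
rewrite size_flatten_enum natr_sum.
apply: (@le_trans _ _ (\sum_(j : idx Phi a) (1 + A * S * y * contr j `^ t))).
  apply: ler_sum => j _; apply: le_trans (hf j).2 _.
  rewrite rhoS (cylinder_rho _ _ _ (cylinder_dfwith _ _ _)) [wj j a]dfwithin.
  rewrite [X in X `^ t]mulrAC.
  rewrite powRM ?divr_ge0 ?(ltW (rho_gt0 _ _)) ?(ltW (contr_gt0 _ _ _)) ?(ltW r0)//.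
  by rewrite !mulrA.
rewrite big_split /= sumr_const -mulr_sumr big_ord_recl -/(level_sum Phi a t).
have -> : \sum_(i < h) block_sum Phi a (lift ord0 i) t = level_sum Phi a t * S.
  by rewrite mulr_sumr; apply: eq_bigr => i _; rewrite -block_sumS.
rewrite {1}/block_sum big_ord0.
have := hA a; set L := level_sum _ _ _.
have : A <= A * y by rewrite ler_peMr.
rewrite cardT -cardE; lra.
Qed.

(** Separated families in the ball have bounded size, so one of maximal size exists. A word [u]
    following none of its members past the scale [r] could be added to it. *)
Lemma maximal_separated_family (c : R) : 0 <= c ->
  exists M : nat, exists2 e : R, 0 < e < 1 &
  forall (r : R) (x : 'cV[R]_d), 0 < r -> r < e ->
  exists (I : finType) (v : I -> symb Phi), (#|I| <= M)%N /\
    forall u : symb Phi, enorm (x - coding X u) <= c * r ->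
      exists i, forall n, r < rho (v i) n -> cylinder (v i) n.+1 u.
Proof.
move=> c0; have [M [e e01 hM]] := separated_family_bound hX hbnc c c0.
exists M, e => // r x r0 re.
pose P k := exists (I : finType) (v : I -> symb Phi), [/\ #|I| = k, word_separated r v
  & forall i, enorm (x - coding X (v i)) <= c * r].
have exP : exists k, `[< P k >].
  exists 0%N; apply/asboolP; exists void, (of_void (symb Phi)).
  by split; [exact: card_void|case|case].
have boundP k : `[< P k >] -> (k <= M)%N.
  by move=> /asboolP[I [v [<- sep vx]]]; exact: (hM r x r0 re I v sep vx).
case: (ex_maxnP exP boundP) => k /asboolP[I [v [Ik sep vx]]] max_k.
exists I, v; split; first by rewrite Ik; apply/boundP/asboolP; exists I, v.
move=> u ux; apply: contrapT => no.
have sepu i : exists n, [/\ v i n != u n, r < rho (v i) n & r < rho u n].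
  apply: contrapT => no'; apply: no; exists i => n rn.
  (* As long as [u] agrees with [v i], both have the same [rho], so a first disagreement at a level
     where it exceeds [r] would separate them. *)
  have agree l : (l <= n.+1)%N -> cylinder (v i) l u.
    elim: l => [|l ih] ln; first by [].
    have cl := ih (ltnW ln); apply: (cylinderS _ _ _ cl).
    apply: contrapT => ne; apply: no'; exists l.
    have rl : r < rho (v i) l by apply: lt_le_trans rn _; apply: rho_anti.
    by split => //; [apply/eqP => /esym|rewrite (cylinder_rho _ _ _ cl)].
  exact: agree.
suff /max_k : `[< P k.+1 >] by rewrite ltnn.
apply/asboolP.
exists (option I), (fun o => if o is Some i then v i else u); split.
- by rewrite card_option Ik.
- move=> [i|] [j|] ij //.
  + by apply: sep => eij; apply: ij; rewrite eij.
  + by have [n [h1 h2 h3]] := sepu j; exists n; split => //; rewrite eq_sym.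
- by case.
Qed.

(** A ball of small radius rr is reached through boundedly many words cut at scale rr, and
    [descendants_cover] at scale r/D covers the part of K below each by balls of radius r. The decay
    of block sums bounds the sum over depths by a geometric series. *)
Lemma assouad_bound_of_block_sum (N m : nat) (s t : R) : 0 <= s -> s < t -> (0 < m)%N ->
  (forall n, (N <= n)%N -> block_sum Phi n m s <= 1) ->
  exists2 C : R, 0 < C & assouad_bound (limit_set Phi X) C t.
Proof.
move=> s0 st m0 hm.
have t0 : 0 <= t by apply: le_trans (ltW st).
have [B B0 hB] := block_sum_bounded _ _ _ s0 m0 hm.
have [K [q [K0 q01 hK]]] := block_sum_decay _ _ _ B0 st hB.
have [A' hA'] := card_idx_bounded hX hbnc.
have hA n : (#|idx Phi n|%:R : R) <= A'%:R by rewrite ler_nat.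
have [D D1 hD] := coding_dist hX.
have D0 : 0 < D by apply: lt_le_trans D1.
(* The constant 2 allows for the distance from a point of K in the ball to the coding of a word
   reaching it, which is at most r <= rr. *)
have [M [e /andP[e0 e1] hM]] := maximal_separated_family 2 (ler0n _ 2).
pose T := K / (1 - q).
have T0 : 0 <= T by rewrite divr_ge0// subr_ge0 ltW//; case/andP: q01.
have hT a h : \sum_(l < h) block_sum Phi a l t <= T.
  apply: (@le_trans _ _ (\sum_(l < h) K * q ^+ l)); first by apply: ler_sum.
  by rewrite -mulr_sumr ler_wpM2l// sum_exprn_le.
pose G := A'%:R * T * D `^ t.
have G0 : 0 <= G by rewrite mulr_ge0 ?powR_ge0// mulr_ge0.
(* The first term serves radii rr < e; the other two serve e <= rr < 1, where all of K is covered
   starting from the empty word. *)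
exists (M%:R * (1 + G) + 1 + G * e^-1 `^ t).
  have p1 : 0 <= M%:R * (1 + G) by rewrite mulr_ge0// addr_ge0.
  have p2 : 0 <= G * e^-1 `^ t by rewrite mulr_ge0// powR_ge0.
  lra.
move=> r rr r0 rrr rr1 x Kx.
have rr0 : 0 < rr by apply: lt_le_trans rrr.
set y := (rr / r) `^ t.
have y1 : 1 <= y.
  by rewrite -(powRr0 (rr / r)) ler_powR// ler_pdivlMr// mul1r.
have rD0 : 0 < r / D by rewrite divr_gt0.
have [L hL] := rho_uniformly_small hX _ rD0.
(* The factor [b] will be 1 for words cut at scale rr and 1/e for the empty word. *)
have cover a w (b : R) : 0 <= b -> (a <= L)%N -> rho w a <= b * rr ->
  exists2 s, covered_by (descendants w a (L - a)) r s &
    (size s)%:R <= 1 + G * b `^ t * y.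
  move=> b0 aL wb.
  have [|l cl hl] := descendants_cover D A'%:R (r / D) t D0 rD0 t0 hA hD (L - a) a w.
    by move=> v; rewrite subnKC// hL.
  exists l; first by move: cl; rewrite mulrCA divff ?gt_eqF// mulr1.
  apply: le_trans hl _; rewrite lerD2l.
  apply: (@le_trans _ _ (A'%:R * T * (rho w a / (r / D)) `^ t)).
    by rewrite ler_wpM2r ?powR_ge0// ler_wpM2l// hT.
  have x0 : 0 <= rr / r by rewrite divr_ge0// ltW.
  have Db0 : 0 <= D * b by rewrite mulr_ge0// ltW.
  have -> : G * b `^ t * y = A'%:R * T * (D * b * (rr / r)) `^ t.
    by rewrite (powRM _ Db0 x0) (powRM _ (ltW D0) b0) -/y /G; ring.
  apply: ler_wpM2l; first by rewrite mulr_ge0.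
  apply: ge0_ler_powR => //; rewrite ?nnegrE.
  - by rewrite divr_ge0// ltW// rho_gt0.
  - exact: mulr_ge0.
  have -> : D * b * (rr / r) = b * rr / (r / D) by field; rewrite !gt_eqF.
  by rewrite ler_wpM2r// invr_ge0 ltW.
have reach z : limit_set Phi X z -> exists v : symb Phi, (scomp v L @` X) z.
  move=> Kz; have [v _ vz] := Kz L.+1 (ltn0Sn _).
  by exists v; apply: (scomp_subset hX _ _ _ _ _ vz); rewrite leqnSn.
have DrL v : rho v L <= rr.
  apply: le_trans (hL L (leqnn L) v) (le_trans _ rrr).
  by rewrite ler_pdivrMr// ler_peMr// ltW.
have [er|re] := leP e rr.
  have [|||l cl hl] := cover 0%N (fun n => idx_inhabited Phi n) e^-1.
  - by rewrite invr_ge0 ltW.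
  - exact: leq0n.
  - by rewrite rho0 mulrC ler_pdivlMr// mul1r.
  apply: le_trans (cover_number_le _ _ l _) _.
    move=> z [_ /reach[v vz]]; apply: cl; exists v => //.
    by rewrite add0n subn0.
  rewrite lee_fin; apply: le_trans hl _.
  have hM0 : 0 <= M%:R * (1 + G) * y by rewrite !mulr_ge0 ?addr_ge0// powR_ge0.
  by rewrite !mulrDl; lra.
have [I [v [IM hv]]] := hM rr x rr0 re.
have [n hn] := choice (fun i => cut_exists hX (v i) rr rr0 rr1).
have nL i : (n i < L)%N.
  rewrite ltnNge; apply/negP => /(rho_anti (v i)) h; have /andP[_ h'] := hn i.
  by have := lt_le_trans h' (le_trans h (DrL (v i))); rewrite ltxx.
have cov i : exists s, covered_by (descendants (v i) (n i).+1 (L - (n i).+1)) r s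
    /\ (size s)%:R <= (1 + G) * y.
  have [|||l cl hl] := cover (n i).+1 (v i) 1; rewrite ?mul1r//.
    by case/andP: (hn i).
  exists l; split => //; apply: le_trans hl _.
  by rewrite powR1 mulr1 mulrDl mul1r lerD2r.
have [f hf] := choice cov.
apply: le_trans (cover_number_le _ _ (flatten [seq f i | i <- enum I]) _) _.
  move=> z [xz /reach[u uz]].
  apply: (covered_by_flatten _ _ _ (fun i => (hf i).1)).
  have [|i hi] := hv u.
    apply: le_trans (enorm_dist_trans z _ _) _; rewrite mulr_natl mulr2n.
    apply: lerD => //; rewrite enormB; apply: le_trans (hD _ _ _ uz) _.
    rewrite mulrC -ler_pdivlMr// (le_trans (hL L (leqnn L) u))//.
    by rewrite ler_wpM2r// invr_ge0 ltW.
  exists i => //; exists u; last by rewrite subnKC.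
  by apply: hi; case/andP: (hn i).
rewrite lee_fin size_flatten_enum natr_sum.
apply: (@le_trans _ _ (\sum_(i : I) (1 + G) * y)).
  by apply: ler_sum => i _; exact: (hf i).2.
have y0 : 0 <= y by apply: le_trans y1.
have Gy : 0 <= (1 + G) * y by rewrite mulr_ge0// addr_ge0.
rewrite sumr_const -[leLHS]mulr_natl.
apply: (@le_trans _ _ (M%:R * ((1 + G) * y))); first by rewrite ler_wpM2r// ler_nat.
rewrite mulrA -addrA [leRHS]mulrDl lerDl mulr_ge0// addr_ge0// mulr_ge0// powR_ge0//.
Qed.

End UpperBound.

(** * Conclusion *)

Lemma ereal_dense {R : realFieldType} (a b : \bar R) : (a < b)%E ->
  exists y : R, (a < y%:E < b)%E.
Proof.
case: a => [a| |]; case: b => [b| |] //.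
- rewrite lte_fin => ab; exists ((a + b) / 2).
  by rewrite !lte_fin; apply/andP; split; lra.
- by move=> _; exists (a + 1); rewrite lte_fin ltrDl ltr01 ltry.
- by move=> _; exists (b - 1); rewrite ltNyr lte_fin gtrDl oppr_lt0 ltr01.
- by move=> _; exists 0; rewrite ltNyr ltry.
Qed.

(** The lower bound is asked only for m > 0, because length 0 is meaningless for [theta]; hence the
    shift by one in the proof. *)
Lemma cvg_of_eventually_squeezed {R : realType} (u : (\bar R)^nat) (l : \bar R) :
  (forall m, (0 < m)%N -> (l <= u m)%E) ->
  (forall y : R, (l < y%:E)%E -> \forall m \near \oo, (u m <= y%:E)%E) ->
  u @ \oo --> l.
Proof.
move=> lu ul; rewrite -cvg_shiftS; apply: limn_esup_le_cvg => [|n]; last exact: lu.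
rewrite leNgt; apply/negP => /ereal_dense[y /andP[ly yu]].
have [m0 _ hm0] := ul y ly.
move: yu; apply/negP; rewrite -leNgt; apply: ge_ereal_inf.
exists (ereal_sup ((fun n => u n.+1) @` [set n | (m0 <= n)%N])).
  by exists [set n | (m0 <= n)%N] => //; exists m0.
apply: ge_ereal_sup => _ [n /= mn <-]; apply: hm0 => /=; exact: leqW.
Qed.

(** For s < 0 the ratio y = R/r below makes C y^s = C/(C+1) < 1, whereas a nonempty set needs at
    least one ball. *)
Lemma assouad_bound_exponent_ge0 {R : realType} {d : nat} (K : set 'cV[R]_d) (C s : R) :
  K !=set0 -> 0 < C -> assouad_bound K C s -> 0 <= s.
Proof.
move=> [x Kx] C0 hC; rewrite leNgt; apply/negP => s0.
have ns : 0 < - s by rewrite oppr_gt0.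
pose y := (C + 1) `^ (- s)^-1.
have C1 : 1 <= C + 1 by rewrite lerDr ltW.
have y1 : 1 <= y by rewrite -(powRr0 (C + 1)) ler_powR// invr_ge0 ltW.
have y0 : 0 < y by apply: lt_le_trans y1.
have ys : y `^ s = (C + 1)^-1.
  have -> : y `^ s = (y `^ (- s))^-1 by rewrite -powRN opprK.
  by rewrite -powRrM mulVf ?gt_eqF// powRr1// addr_ge0// ltW.
have half1 : 2^-1 < 1 :> R by rewrite invf_lt1 ?ltr1n.
have := hC (2^-1 / y) 2^-1 _ _ half1 x Kx.
have -> : 2^-1 / (2^-1 / y) = y by field; rewrite !gt_eqF.
rewrite ys => /(_ _ _)/le_lt_trans => h.
have : (cover_number (eball x 2^-1 `&` K) (2^-1 / y) < 1)%E.
  apply: h; rewrite ?divr_gt0 ?invr_gt0//.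
    by rewrite ler_pdivrMr// ler_peMr// invr_ge0.
  rewrite lte_fin ltr_pdivrMr ?mul1r; lra.
apply/negP; rewrite -leNgt; apply: le_ereal_inf_tmp => _ [N [c hc] <-].
rewrite lee_fin ler1n lt0n; apply/eqP => N0; subst N.
have [|[]//] := hc x.
split=> //; rewrite /eball /closed_ball_ /= subrr -(scale0r x) enormZ// mul0r.
by rewrite invr_ge0.
Qed.

Section Dimension.
Context {R : realType} {d : nat} {Phi : sim_seq R d} {X : set 'cV[R]_d}.
Hypotheses (hX : is_nifs Phi X) (hbnc : bounded_neighbourhood Phi X).

(** Otherwise there are reals s < t strictly between the two sides. Then theta(n,m) < s for large n,
    so the block sums at s are at most 1 and t is an admissible exponent below the dimension. *)
Lemma assouad_dim_le_limn_esup m : (0 < m)%N ->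
  (assouad_dim (limit_set Phi X) <= limn_esup (fun n => (theta Phi n m)%:E))%E.
Proof.
move=> m0; rewrite leNgt; apply/negP => /ereal_dense[t /andP[]].
move=> /ereal_dense[s /andP[+ st]] tD; rewrite /limn_esup limf_esupE.
move=> /ereal_inf_lt[_ [V [N _ NV] <-] hV].
have th n : (N <= n)%N -> theta Phi n m < s.
  move=> Nn; rewrite -lte_fin; apply: le_lt_trans hV.
  by apply: ereal_sup_ubound; exists n => //; exact: NV.
have s0 : 0 <= s by apply/ltW/(le_lt_trans (theta_spec Phi N m m0).1)/th.
have [C C0 hC] := assouad_bound_of_block_sum hX hbnc N m s t s0 st m0
  (fun n Nn => block_sum_le1 _ _ _ _ m0 (ltW (th n Nn))).
move: tD; apply/negP; rewrite -leNgt; apply: ereal_inf_lbound.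
by exists t => //; exists C.
Qed.

Lemma theta_sup_eventually_le (y : R) : (assouad_dim (limit_set Phi X) < y%:E)%E ->
  \forall m \near \oo, (ereal_sup [set (theta Phi n m)%:E | n in [set: nat]] <= y%:E)%E.
Proof.
move=> /ereal_inf_lt[_ [s [C C0 hC] <-]]; rewrite lte_fin => sy.
have s0 : 0 <= s.
  apply: (assouad_bound_exponent_ge0 (limit_set Phi X) C) => //.
  by exists (coding X (fun n => idx_inhabited Phi n)); exact: coding_limit_set.
have [m0 hm0] := theta_eventually_le hX hbnc C s y C0 s0 sy hC.
exists m0 => // m /= mm; apply: ge_ereal_sup => _ [n _ <-].
by rewrite lee_fin hm0.
Qed.

Lemma limn_esup_theta_le_sup m :
  (limn_esup (fun n => (theta Phi n m)%:E) <=
   ereal_sup [set (theta Phi n m)%:E | n in [set: nat]])%E.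
Proof. by apply: ereal_inf_lbound; exists [set: nat] => //; exact: filterT. Qed.

End Dimension.

Theorem theoremA (R : realType) (d : nat) (Phi : sim_seq R d)
    (X : set 'cV[R]_d) (hX : is_nifs Phi X)
    (hbnc : bounded_neighbourhood Phi X) :
  [/\ (fun m : nat => ereal_sup [set (theta Phi n m)%:E | n in [set: nat]])
        @ \oo --> assouad_dim (limit_set Phi X),
      (fun m : nat => limn_esup (fun n : nat => (theta Phi n m)%:E))
        @ \oo --> assouad_dim (limit_set Phi X)
    & assouad_dim (limit_set Phi X)
      = ereal_inf [set limn_esup (fun n : nat => (theta Phi n m)%:E)
                  | m in [set m : nat | (1 <= m)%N]]].
Proof.
have lb := assouad_dim_le_limn_esup hX hbnc.
have ub := theta_sup_eventually_le hX hbnc.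
have ub' (y : R) : (assouad_dim (limit_set Phi X) < y%:E)%E ->
    \forall m \near \oo, (limn_esup (fun n => (theta Phi n m)%:E) <= y%:E)%E.
  by move=> /ub[m0 _ h]; exists m0 => // m /h; exact/le_trans/limn_esup_theta_le_sup.
split.
- apply: cvg_of_eventually_squeezed => // m m0.
  by apply: le_trans (lb m m0) (limn_esup_theta_le_sup _).
- exact: cvg_of_eventually_squeezed.
apply/eqP; rewrite eq_le; apply/andP; split.
  by apply: le_ereal_inf_tmp => _ [m m0 <-]; exact: lb.
rewrite leNgt; apply/negP => /ereal_dense[y /andP[/ub'[m0 _ h]]].
(* The index [m0.+1] is positive, as membership in the infimum requires. *)
apply/negP; rewrite -leNgt; apply: le_trans (h m0.+1 (leqnSn _)).
by apply: ereal_inf_lbound; exists m0.+1.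
Qed.
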